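(* Let $p$ be a prime and $q=p^2$, let $r,k\ge 0$ be integers, and put $\vec r=(r,r)$. Then the representation $V_{\vec r}(k)$ of $\mathrm{GL}_2(\mathbb F_q)$ is $(\mathrm{GL}_2(\mathbb F_p),\det^{r+k})$-distinguished, i.e. $$\mathrm{Hom}_{\mathrm{GL}_2(\mathbb F_p)}\left(V_{\vec r}(k),\det{}^{r+k}\right)\neq 0.$$
   Context: All representations are over a fixed algebraic closure $\overline{\mathbb F}_p$ of $\mathbb F_p$. For $r\ge 0$, $\mathrm{Sym}^r(\overline{\mathbb F}_p^2)$ is the space of homogeneous polynomials of degree $r$ in two variables $x,y$ over $\overline{\mathbb F}_p$, with $\begin{pmatrix}a&b\\c&d\end{pmatrix}\cdot P(x,y)=P(ax+cy,bx+dy)$. For $q=p^2$ and $\vec r=(r_1,r_2)$, $V_{\vec r}(k)$ is the representation $\mathrm{Sym}^{r_1}(\overline{\mathbb F}_p^2)\otimes\mathrm{Sym}^{r_2}(\overline{\mathbb F}_p^2)\otimes\det^k$ of $\mathrm{GL}_2(\mathbb F_q)$, in which $\begin{pmatrix}a&b\\c&d\end{pmatrix}$ acts on the first factor by $P(x,y)\mapsto P(ax+cy,bx+dy)$, on the second factor through $\begin{pmatrix}a^{p}&b^{p}\\c^{p}&d^{p}\end{pmatrix}$, i.e. by $P(x,y)\mapsto P(a^px+c^py,b^px+d^py)$, and the whole is twisted by the $k$-th power of the determinant. For $H\le G$ and a character $\chi$ of $H$, a representation $\pi$ of $G$ is $(H,\chi)$-distinguished if $\mathrm{Hom}_H(\pi,\chi)\ne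 0$. *)

(* Defs.v *)
From HB Require Import structures.
From mathcomp Require Import all_boot all_order all_algebra all_fingroup.
From mathcomp Require Import all_solvable all_field all_character.
From mathcomp Require Import mpoly.

Set Implicit Arguments.
Unset Strict Implicit.
Unset Printing Implicit Defensive.

Import GRing.Theory passmx.
Local Open Scope ring_scope.

(* All modules below are left modules: a matrix representation rG acts on
   column vectors by v |-> rG g *m v, and an equivariant map from rG to sG is
   applied by left multiplication, so f intertwines when f rG h = sG h f.
   MathComp's own module notions (mxmodule, mx_rsim, ...) use row vectors. *)

Section Distinguished.

Variables (K : fieldType) (gT : finGroupType).

Definition mx_intertwines (H : {group gT}) m n
    (rG : mx_representation K H m) (sG : mx_representation K H n)
    (f : 'M[K]_(n, m)) : Prop :=
  {in H, forall h, f *m rG h = sG h *m f}.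

Definition distinguished (G H : {group gT}) (sHG : H \subset G) n
    (rG : mx_representation K G n) (chi : mx_representation K H 1) : Prop :=
  exists2 f : 'M[K]_(1, n), mx_intertwines (subg_repr rG sHG) chi f & f != 0.

End Distinguished.

Section SymPower.

Variables (K : fieldType) (r : nat).

Local Notation Sym := (dhomog 2 K r).

(* For A = (a b; c d), x = 'X_0 and y = 'X_1, this is the pair
   (a x + c y, b x + d y). *)
Definition lin_subst (A : 'M[K]_2) : 2.-tuple {mpoly K[2]} :=
  [tuple \sum_i A i j *: 'X_i | j < 2].

Lemma lin_substE A j : tnth (lin_subst A) j = \sum_i A i j *: 'X_i.
Proof. by rewrite tnth_mktuple. Qed.

Lemma lin_subst_homog (A : 'M[K]_2) (P : Sym) :
  (P : {mpoly K[2]}) \mPo lin_subst A \is r.-homog.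
Proof.
case: P => P homP /=; rewrite comp_mpolyEX big_seq rpred_sum // => m Pm.
apply: rpredZ; rewrite -(dhomog_mf homP Pm) comp_mpolyX /= mdegE.
elim/big_rec2: _ => [|j q d _ homq]; first exact: dhomog1.
apply: dhomogM homq; rewrite -[X in X.-homog]mul1n.
apply: dhomogMn; rewrite lin_substE rpred_sum // => i _.
by apply: rpredZ; rewrite dhomogX /= mdeg1.
Qed.

Definition sym_act (A : 'M[K]_2) (P : Sym) : Sym :=
  DHomog (lin_subst_homog A P).

Lemma sym_act_is_linear A : linear (sym_act A).
Proof. by move=> c P Q; apply/val_inj; rewrite /= linearP. Qed.

Lemma sym_act1 P : sym_act 1%:M P = P.
Proof.
apply/val_inj; rewrite /= -[RHS]comp_mpoly_id; congr (_ \mPo _).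
apply: eq_from_tnth => j; rewrite !tnth_mktuple (bigD1 j) //= mxE eqxx scale1r.
by rewrite big1 ?addr0 // => i /negbTE nij; rewrite mxE nij scale0r.
Qed.

Lemma sym_actM A B P : sym_act (A *m B) P = sym_act A (sym_act B P).
Proof.
apply/val_inj; rewrite /= (comp_mpolyEX _ (lin_subst B)) raddf_sum /=.
rewrite comp_mpolyEX; apply: eq_bigr => m _; rewrite comp_mpolyZ; congr (_ *: _).
rewrite !comp_mpolyX rmorph_prod; apply: eq_bigr => j _.
rewrite rmorphXn /= !lin_substE; congr (_ ^+ _); rewrite raddf_sum /=.
under [RHS]eq_bigr => k _ do
  rewrite comp_mpolyZ comp_mpolyXU -tnth_nth lin_substE scaler_sumr.
rewrite exchange_big /=; apply: eq_bigr => i _; rewrite mxE scaler_suml.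
by apply: eq_bigr => k _; rewrite scalerA mulrC.
Qed.

HB.instance Definition _ A :=
  GRing.isLinear.Build K Sym Sym *:%R (sym_act A) (sym_act_is_linear A).

(* mxof is the matrix acting on rows, whence the transpose. *)
Definition sym_mx (A : 'M[K]_2) : 'M[K]_(\dim {:Sym}) :=
  (mxof (vbasis {:Sym}) (vbasis {:Sym}) (linfun (sym_act A)))^T.

Lemma sym_mxE A (P : Sym) :
  sym_mx A *m (rVof (vbasis {:Sym}) P)^T =
    (rVof (vbasis {:Sym}) (sym_act A P))^T.
Proof. by rewrite -trmx_mul -(rVof_app _ (vbasisP _)) lfunE. Qed.

Lemma sym_mx1 : sym_mx 1%:M = 1%:M.
Proof.
rewrite /sym_mx -[RHS]trmx1 -(mxof1 (basis_free (vbasisP {:Sym}))).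
by do 2!congr (_ _); apply/lfunP => P; rewrite !lfunE /= sym_act1.
Qed.

Lemma sym_mxM A B : sym_mx (A *m B) = sym_mx A *m sym_mx B.
Proof.
rewrite /sym_mx -trmx_mul -(mxof_comp _ _ (vbasisP {:Sym})).
by do 2!congr (_ _); apply/lfunP => P; rewrite comp_lfunE !lfunE /= sym_actM.
Qed.

End SymPower.

Section GLRepresentations.

Variables (F : finFieldType) (K : fieldType).

(* sym_repr tau r is Sym^r of the standard representation, on which the
   matrices over F act through the ring morphism tau. *)
Lemma sym_mx_repr (tau : {rmorphism F -> K}) r :
  mx_repr 'GL_2[F] (fun g : {'GL_2[F]} => sym_mx r (map_mx tau g)).
Proof.
split=> [|g h _ _]; first by rewrite map_mx1 sym_mx1.
by rewrite map_mxM sym_mxM.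
Qed.

Definition sym_repr (tau : {rmorphism F -> K}) r :=
  MxRepresentation (sym_mx_repr tau r).

Lemma detX_mx_repr (tau : {rmorphism F -> K}) k :
  mx_repr 'GL_2[F]
    (fun g : {'GL_2[F]} => (tau (\det g) ^+ k)%:M : 'M[K]_1).
Proof.
split=> [|g h _ _]; first by rewrite det1 rmorph1 expr1n.
by rewrite det_mulmx rmorphM exprMn scalar_mxM.
Qed.

Definition detX_repr (tau : {rmorphism F -> K}) k :=
  MxRepresentation (detX_mx_repr tau k).

Definition V_repr p (charF : p \in [pchar F]) (toK : {rmorphism F -> K})
    (r1 r2 k : nat) :=
  prod_repr
    (prod_repr (sym_repr toK r1) (sym_repr (toK \o pFrobenius_aut charF) r2))
    (detX_repr toK k).

End GLRepresentations.

Section PrimeSubfield.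

Variables (p : nat) (F : finFieldType) (toF : {rmorphism 'F_p -> F}).

Lemma pchar_Fp_ext : prime p -> p \in [pchar F].
Proof. by move=> p_pr; rewrite (fmorph_pchar toF) pchar_Fp. Qed.

Lemma GLmap_unit (g : {'GL_2(p)}) : map_mx toF g \is a GRing.unit.
Proof. by rewrite -[_ \is a _]/(_ \in unitmx) map_unitmx GL_unitmx. Qed.

Definition GLmap (g : {'GL_2(p)}) : {'GL_2[F]} :=
  FinRing.Unit (GLmap_unit g).

Lemma GLmapM : {in 'GL_2(p)%g &, {morph GLmap : g h / (g * h)%g}}.
Proof. by move=> g h _ _; apply/val_inj; rewrite /= map_mxM. Qed.

Canonical GLmap_morphism := Morphism GLmapM.

Definition GLFp : {group {'GL_2[F]}} := (GLmap @* 'GL_2(p))%G.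

Lemma GLFp_sub : GLFp \subset 'GL_2[F]%G.
Proof. exact: subsetT. Qed.

End PrimeSubfield.

(* Main.v *)
Require Import Defs.
From mathcomp Require Import all_boot all_order all_algebra all_fingroup.
From mathcomp Require Import all_solvable all_field all_character.
From mathcomp Require Import mpoly.
From mathcomp Require Import ring.

Set Implicit Arguments.
Unset Strict Implicit.
Unset Printing Implicit Defensive.

Import GRing.Theory passmx.
Local Open Scope ring_scope.

(* On GL_2(F_p) the Frobenius twist disappears, so the claim is that Sym^r
   carries a nonzero bilinear form beta with beta(gP, gQ) = det(g)^r beta(P, Q).
   If r < p, the classical apolar pairing P(d/dy, -d/dx) Q works: r! is
   invertible, so the r-th powers of linear forms span Sym^r, and pairing with
   the power attached to v is r! times evaluation at the rotated vector Jv.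
   If r >= p, take the sum of (v ^ w)^m P(v) Q(w) over v, w in F_p^2, with
   m = -r mod p - 1; it is nonzero because for r >= p there are forms of
   degree r vanishing at all points of P^1(F_p) but one. *)

(** * Maps known to be linear only through a hypothesis *)

Section LinearCombinations.

Variables (K : pzRingType) (U V : lmodType K) (f : U -> V).
Hypothesis f_lin : linear f.

Lemma linear_zero : f 0 = 0.
Proof.
by have := f_lin (-1) 0 0; rewrite scaleN1r oppr0 addr0 scaleN1r addNr.
Qed.

Lemma linear_scale c u : f (c *: u) = c *: f u.
Proof. by rewrite -[c *: u]addr0 f_lin linear_zero addr0. Qed.

Lemma linear_comb (I : Type) (s : seq I) (P : pred I) c (u : I -> U) :
  f (\sum_(i <- s | P i) c i *: u i) = \sum_(i <- s | P i) c i *: f (u i).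
Proof.
elim/big_rec2: _ => [|i w v _ <-]; [exact: linear_zero | exact: f_lin].
Qed.

End LinearCombinations.

(** * Kronecker products, and bilinear forms as linear forms on a tensor square *)

Section TensorProduct.

Variable K : fieldType.

(** Induction on the rows of the first factor, following the recursion that defines [tprod]. *)
Lemma tprod_linearl m1 n1 m2 n2 (B : 'M[K]_(m2, n2)) :
  linear (fun A : 'M[K]_(m1, n1) => tprod A B).
Proof.
elim: m1 => [|m1 IH] c A1 A2; first by apply/matrixP => -[].
rewrite /= linearP /= linearP /= -!trowbE linearP /= IH.
by rewrite scale_col_mx add_col_mx.
Qed.

Lemma tprod_linearr m1 n1 m2 n2 (A : 'M[K]_(m1, n1)) :
  linear (fun B : 'M[K]_(m2, n2) => tprod A B).
Proof.
elim: m1 A => [|m1 IH] A c B1 B2; first by apply/matrixP => -[].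
by rewrite /= linearP /= IH scale_col_mx add_col_mx.
Qed.

(* For row vectors [rewrite -tprodE] fails: the number of rows of the product
   is [1], and [tprodE] expects [1 * 1]. *)
Lemma tprod_rowM n1 p1 n2 p2 (u : 'rV[K]_n1) (v : 'rV[K]_n2)
    (A : 'M[K]_(n1, p1)) (B : 'M[K]_(n2, p2)) :
  (tprod u v : 'rV_(n1 * n2)) *m tprod A B = tprod (u *m A) (v *m B).
Proof. by rewrite tprodE. Qed.

Lemma tprod_suml m1 n1 m2 n2 (B : 'M[K]_(m2, n2)) (I : finType)
    (c : I -> K) (A : I -> 'M[K]_(m1, n1)) :
  tprod (\sum_i c i *: A i) B = \sum_i c i *: tprod (A i) B.
Proof. exact: (linear_comb (tprod_linearl B)). Qed.

Lemma tprod_sumr m1 n1 m2 n2 (A : 'M[K]_(m1, n1)) (I : finType)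
    (c : I -> K) (B : I -> 'M[K]_(m2, n2)) :
  tprod A (\sum_i c i *: B i) = \sum_i c i *: tprod A (B i).
Proof. exact: (linear_comb (tprod_linearr A)). Qed.

Lemma tprodZl m1 n1 m2 n2 c (A : 'M[K]_(m1, n1)) (B : 'M[K]_(m2, n2)) :
  tprod (c *: A) B = c *: tprod A B.
Proof. exact: (linear_scale (tprod_linearl B)). Qed.

Lemma tprodZr m1 n1 m2 n2 c (A : 'M[K]_(m1, n1)) (B : 'M[K]_(m2, n2)) :
  tprod A (c *: B) = c *: tprod A B.
Proof. exact: (linear_scale (tprod_linearr A)). Qed.

Lemma tprod0l m1 n1 m2 n2 (B : 'M[K]_(m2, n2)) :
  tprod (0 : 'M[K]_(m1, n1)) B = 0.
Proof. exact: (linear_zero (tprod_linearl B)). Qed.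

Lemma tprod0r m1 n1 m2 n2 (A : 'M[K]_(m1, n1)) :
  tprod A (0 : 'M[K]_(m2, n2)) = 0.
Proof. exact: (linear_zero (tprod_linearr A)). Qed.

(** Multiplying by [tprod (delta_mx j 0) 1%:M] reads off the entry [A 0 j]. This strips the
    one-dimensional determinant factor of [V_repr]. *)
Lemma tprod1r_eq0 n (A : 'rV[K]_n) : tprod A (1%:M : 'M_1) = 0 -> A = 0.
Proof.
move=> A0; apply/rowP => j; rewrite mxE.
have : tprod A (1%:M : 'M_1) *m tprod (delta_mx j 0 : 'cV_n) (1%:M : 'M_1)
    = (A 0 j)%:M.
  have Aj : A *m delta_mx j 0 = A 0 j *: 1%:M :> 'M_1.
    by apply/matrixP => a b; rewrite -colE !mxE !ord1 mulr1.
  by rewrite -tprodE Aj mulmx1 tprodZl tprod1 scalemx1.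
by rewrite A0 mul0mx => /matrixP/(_ 0 0); rewrite !mxE.
Qed.

(* The linear form on the tensor square that sends [tprod u v] to
   [u^T *m G *m v]. *)
Definition form_mx n (G : 'M[K]_n) : 'M[K]_(1 * 1, n * n) :=
  \sum_i \sum_j G i j *: tprod (delta_mx 0 i : 'rV_n) (delta_mx 0 j : 'rV_n).

Lemma form_mxZ n c (G : 'M[K]_n) : form_mx (c *: G) = c *: form_mx G.
Proof.
rewrite /form_mx scaler_sumr; apply: eq_bigr => i _; rewrite scaler_sumr.
by apply: eq_bigr => j _; rewrite scalerA mxE.
Qed.

(** Expanding rows [i] and [j] of [A] in the standard basis gives a fourfold sum; summing over [i]
    and [j] first leaves the entries of the congruent matrix. *)
Lemma form_mxM n (G A : 'M[K]_n) :
  form_mx G *m tprod A A = form_mx (A^T *m G *m A).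
Proof.
rewrite /form_mx.
transitivity (\sum_i \sum_j \sum_k \sum_l (G i j * A i k * A j l) *:
    tprod (delta_mx 0 k : 'rV_n) (delta_mx 0 l : 'rV_n)).
  rewrite mulmx_suml; apply: eq_bigr => i _; rewrite mulmx_suml.
  apply: eq_bigr => j _; rewrite -scalemxAl -tprodE -!rowE.
  rewrite (row_sum_delta (row i A)) (row_sum_delta (row j A)) tprod_suml.
  rewrite scaler_sumr; apply: eq_bigr => k _.
  rewrite tprod_sumr !scaler_sumr; apply: eq_bigr => l _.
  by rewrite !scalerA !mxE.
under eq_bigr do rewrite exchange_big.
rewrite exchange_big /=; apply: eq_bigr => k _.
under eq_bigr do rewrite exchange_big.
rewrite exchange_big /=; apply: eq_bigr => l _.
rewrite mxE scaler_suml exchange_big /=; apply: eq_bigr => j _.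
rewrite mxE mulr_suml scaler_suml; apply: eq_bigr => i _.
by rewrite mxE [A i k * _]mulrC.
Qed.

(** The value on the tensor of the [k]-th and [l]-th basis columns is [G k l]. *)
Lemma form_mx_eq0 n (G : 'M[K]_n) : form_mx G = 0 -> G = 0.
Proof.
move=> G0; apply/matrixP => k l; rewrite mxE.
have : form_mx G *m tprod (delta_mx k 0 : 'cV_n) (delta_mx l 0 : 'cV_n)
    = (G k l)%:M.
  rewrite /form_mx mulmx_suml (bigD1 k) //= [X in _ + X]big1 ?addr0 => [|i ik].
    rewrite mulmx_suml (bigD1 l) //= [X in _ + X]big1 ?addr0 => [|j jl].
      rewrite -scalemxAl -tprodE !mul_delta_mx.
      have -> : delta_mx 0 0 = 1%:M :> 'M[K]_1.
        by apply/matrixP => a b; rewrite !mxE !ord1.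
      by rewrite tprod1 scalemx1.
    by rewrite -scalemxAl -tprodE (mul_delta_mx_0 _ _ _ jl) tprod0r scaler0.
  rewrite mulmx_suml big1 // => j _.
  by rewrite -scalemxAl -tprodE (mul_delta_mx_0 _ _ _ ik)
    tprod0l scaler0.
by rewrite G0 mul0mx => /matrixP/(_ 0 0); rewrite !mxE.
Qed.

End TensorProduct.

(** * Gram matrices of bilinear forms on [Sym] *)

Section GramMatrix.

Variables (K : fieldType) (r : nat).

Local Notation Sym := (dhomog 2 K r).
Local Notation e := (vbasis {:Sym}).

Variable beta : Sym -> Sym -> K^o.
Hypothesis beta_linl : forall Q, linear (beta^~ Q).
Hypothesis beta_linr : forall P, linear (beta P).

Definition gram_mx : 'M[K]_(\dim {:Sym}) := \matrix_(i, j) beta e`_i e`_j.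

Lemma form_gramE P Q :
  beta P Q = (rVof e P *m gram_mx *m (rVof e Q)^T) 0 0.
Proof.
rewrite mxE [X in beta X](coord_vbasis (memvf P)).
rewrite [in LHS](coord_vbasis (memvf Q)).
rewrite (linear_comb (beta_linr _)); apply: eq_bigr => j _.
rewrite (linear_comb (beta_linl _)) mxE [LHS]mulrC mxE coord_rVof.
congr (_ * _); apply: eq_bigr => i _.
by rewrite !mxE.
Qed.

(** The columns of [sym_mx r A] are the coordinates of the transformed basis vectors, so the entries
    on the left are the values of [beta] on pairs of these. *)
Lemma gram_mx_act (A : 'M[K]_2) c :
  (forall P Q, beta (sym_act A P) (sym_act A Q) = c * beta P Q) ->
  (sym_mx r A)^T *m gram_mx *m sym_mx r A = c *: gram_mx.
Proof.
move=> beta_act; apply/matrixP => i j.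
have actE (l : 'I_(\dim {:Sym})) :
    (rVof e (sym_act A e`_l))^T = col l (sym_mx r A).
  by rewrite -sym_mxE (rVofE (vbasisP _)) trmx_delta -colE.
rewrite [RHS]mxE [gram_mx i j]mxE -beta_act form_gramE actE.
rewrite -[rVof _ _]trmxK actE tr_col -row_mul colE mulmxA -colE.
by rewrite -row_mul !mxE.
Qed.

End GramMatrix.

(** * Binary forms: monomials, evaluation, powers of linear forms *)

Section BinaryForms.

Variables (K : fieldType) (r : nat).

Local Notation Sym := (dhomog 2 K r).

Definition mnm2 i : 'X_{1..2} := [multinom [tuple i; r - i]%N].

Lemma mdeg_mnm2 i : (i <= r)%N -> mdeg (mnm2 i) = r.
Proof.
move=> le_ir; rewrite mdegE !big_ord_recl big_ord0 !mnm_tnth /=.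
by rewrite addn0 subnKC.
Qed.

Lemma mnm2_inj : injective mnm2.
Proof.
by move=> i j /(congr1 (fun m : 'X_{1..2} => m ord0)); rewrite !mnm_tnth.
Qed.

Lemma mdeg_eq_mnm2 m : mdeg m = r -> m = mnm2 (m ord0).
Proof.
rewrite mdegE !big_ord_recl big_ord0 addn0 => degm; apply/mnmP => j.
rewrite [RHS]mnm_tnth (tnth_nth 0%N) /= -degm.
case: j => -[|[|//]] lt_j2 /=; first by congr (m _); apply/val_inj.
by rewrite addKn; congr (m _); apply/val_inj.
Qed.

Lemma homogE (P : Sym) :
  (P : {mpoly K[2]}) = \sum_(i < r.+1) P@_(mnm2 i) *: 'X_[mnm2 i].
Proof.
apply/mpolyP => m; rewrite raddf_sum /=.
under eq_bigr do rewrite mcoeffZ mcoeffX.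
have [degm|degm] := eqVneq (mdeg m) r; last first.
  rewrite (dhomog_nemf_coeff (valP P) degm) big1 // => i _.
  case: eqP => [def_m|_]; last by rewrite mulr0.
  by case/eqP: degm; rewrite -def_m mdeg_mnm2 // -ltnS.
have lt_m : (m ord0 < r.+1)%N.
  by rewrite ltnS -degm mdegE !big_ord_recl leq_addr.
rewrite (bigD1 (Ordinal lt_m)) //= -mdeg_eq_mnm2 // eqxx mulr1.
rewrite big1 ?addr0 // => i ne_im.
case: eqP => [def_m|_]; last by rewrite mulr0.
case/eqP: ne_im; apply/val_inj/mnm2_inj; by rewrite def_m /= -mdeg_eq_mnm2.
Qed.

Lemma meval2 (v : 'rV[K]_2) (P : Sym) :
  P.@[v 0] = \sum_(i < r.+1) P@_(mnm2 i) * (v 0 0 ^+ i * v 0 1 ^+ (r - i)).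
Proof.
rewrite [in LHS]homogE raddf_sum /=; apply: eq_bigr => i _.
rewrite mevalZ mevalX !big_ord_recl big_ord0 mulr1 !mnm_tnth /=.
by congr (_ * (v 0 _ ^+ _ * v 0 _ ^+ _)); apply/val_inj.
Qed.

Lemma mevalZ_homog c (v : 'rV[K]_2) (P : Sym) :
  P.@[(c *: v) 0] = c ^+ r * P.@[v 0].
Proof.
rewrite !meval2 mulr_sumr; apply: eq_bigr => i _; rewrite !mxE !exprMn.
have le_ir : (i <= r)%N by rewrite -ltnS.
by rewrite -[in c ^+ r](subnKC le_ir) exprD; ring.
Qed.

(** Substitution uses the columns of [A], so it moves evaluation points, taken as rows, by right
    multiplication. *)
Lemma meval_act (A : 'M[K]_2) (v : 'rV[K]_2) (P : {mpoly K[2]}) :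
  (P \mPo lin_subst A).@[v 0] = P.@[(v *m A) 0].
Proof.
rewrite comp_mpoly_meval; apply: meval_eq => j.
rewrite lin_substE raddf_sum mxE; apply: eq_bigr => i _ /=.
by rewrite mevalZ mevalXU mulrC.
Qed.

Lemma mnm2_homog (i : 'I_r.+1) : 'X_[mnm2 i] \is [in K[2], r.-homog].
Proof. by rewrite dhomogX /= mdeg_mnm2 // -ltnS. Qed.

Definition monomial (i : 'I_r.+1) : Sym := DHomog (mnm2_homog i).

Lemma sym_monomialE (P : Sym) :
  P = \sum_(i < r.+1) P@_(mnm2 i) *: monomial i.
Proof.
apply/val_inj; rewrite [LHS]homogE /= [RHS]raddf_sum.
exact: eq_bigr.
Qed.

(** The [r]-th power of the linear form with coefficients [v], written out by the binomial theorem
    so that it lies in [Sym] with visible coefficients. *)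
Definition power_form (v : 'cV[K]_2) : Sym :=
  \sum_(i < r.+1) ('C(r, i)%:R * v 0 0 ^+ i * v 1 0 ^+ (r - i)) *: monomial i.

Lemma power_formE (v : 'cV[K]_2) :
  power_form v = (\sum_j v j 0 *: 'X_j) ^+ r :> {mpoly K[2]}.
Proof.
rewrite big_ord_recl big_ord1 addrC exprDn raddf_sum; apply: eq_bigr => i _ /=.
rewrite (mpolyXE _ 1) !big_ord_recl big_ord0 mulr1 !perm1 !mnm_tnth /= !exprZn.
rewrite -scalerAl -scalerAr scalerA -scaler_nat scalerA.
have -> : lift ord0 ord0 = 1 :> 'I_2 by apply/val_inj.
have -> : ord0 = 0 :> 'I_2 by apply/val_inj.
by congr (_ *: _); [rewrite mulrAC mulrA | rewrite [RHS]mulrC].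
Qed.

Lemma sym_act_power (A : 'M[K]_2) v :
  sym_act A (power_form v) = power_form (A *m v).
Proof.
apply/val_inj; rewrite /= !power_formE rmorphXn /=; congr (_ ^+ _).
rewrite raddf_sum /=.
under eq_bigr => j _ do
  rewrite comp_mpolyZ comp_mpolyXU -tnth_nth lin_substE scaler_sumr.
rewrite exchange_big /=; apply: eq_bigr => i _; rewrite mxE scaler_suml.
by apply: eq_bigr => j _; rewrite scalerA mulrC.
Qed.

Lemma mcoeff_power v (i : 'I_r.+1) :
  (power_form v)@_(mnm2 i) = 'C(r, i)%:R * v 0 0 ^+ i * v 1 0 ^+ (r - i).
Proof.
rewrite [X in mcoeff _ X]raddf_sum raddf_sum (bigD1 i) //=.
rewrite mcoeffZ mcoeffX eqxx mulr1.
rewrite big1 ?addr0 // => j ne_ji; rewrite mcoeffZ mcoeffX.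
by rewrite (inj_eq mnm2_inj) val_eqE (negbTE ne_ji) mulr0.
Qed.

(* The coefficients of [t ^+ i] in [f (power_form (t, 1))] are the values of
   [f] at the monomials, up to binomial coefficients. *)
Lemma power_span (f : Sym -> K^o) (s : seq K) :
  linear f -> uniq s -> (r < size s)%N ->
  (forall i : 'I_r.+1, 'C(r, i)%:R != 0 :> K) ->
  {in s, forall t, f (power_form (\col_j (if j == 0 then t else 1))) = 0} ->
  forall P, f P = 0.
Proof.
move=> f_lin s_uniq lt_rs bin_neq0 f0 P.
pose q : {poly K} :=
  \poly_(i < r.+1) ('C(r, i)%:R * f (monomial (inord i)) : K).
have q0 : q = 0.
  apply/eqP/negPn/negP => q_neq0.
  have /(max_poly_roots q_neq0)/(_ s_uniq) : all (root q) s.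
    apply/allP => t /f0; rewrite (linear_comb f_lin) => fs0.
    rewrite /root horner_poly -[X in _ == X]fs0; apply/eqP/eq_bigr => i _.
    by rewrite inord_val !mxE /= expr1n mulr1 mulrAC.
  by rewrite ltnNge (leq_trans (size_poly _ _)).
rewrite [P]sym_monomialE (linear_comb f_lin) big1 // => i _.
have := congr1 (fun u : {poly K} => u`_i) q0; rewrite coef_poly ltn_ord coef0.
move/eqP; rewrite inord_val mulf_eq0 (negbTE (bin_neq0 i)) => /eqP ->.
by rewrite scaler0.
Qed.

End BinaryForms.

Lemma det2 (K : comPzRingType) (A : 'M[K]_2) :
  \det A = A 0 0 * A 1 1 - A 0 1 * A 1 0.
Proof.
rewrite (expand_det_row A 0) big_ord_recl big_ord1 /cofactor !det_mx11 !mxE /=.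
rewrite expr0 mul1r expr1 mulN1r mulrN.
by congr (A _ _ * A _ _ - A _ _ * A _ _); apply/val_inj.
Qed.

(** * The apolar pairing, invariant when [r!] is invertible *)

Section SmallDegree.

Variables (K : fieldType) (r : nat).

Local Notation Sym := (dhomog 2 K r).

(* Up to sign [P(d/dy, -d/dx) Q], for [P] and [Q] of degree [r]. *)
Definition apolar (P Q : Sym) : K^o :=
  \sum_(i < r.+1) ((-1) ^+ i * (i`! * (r - i)`!)%:R) *
    (P@_(mnm2 r i) * Q@_(mnm2 r (r - i))).

Lemma apolar_linl Q : linear (apolar^~ Q).
Proof.
move=> c P1 P2; rewrite /apolar scaler_sumr -big_split; apply: eq_bigr => i _.
by rewrite /= linearP /= -[_ *: _]/(_ * _); ring.
Qed.

Lemma apolar_linr P : linear (apolar P).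
Proof.
move=> c Q1 Q2; rewrite /apolar scaler_sumr -big_split; apply: eq_bigr => i _.
by rewrite /= linearP /= -[_ *: _]/(_ * _); ring.
Qed.

(** This is [v^T J] with [J = (0 -1; 1 0)]. *)
Definition rot2 (v : 'cV[K]_2) : 'rV[K]_2 :=
  \row_j (if j == 0 then v 1 0 else - v 0 0).

(** The weight [i! (r - i)!] turns the binomial coefficient into [r!], and the sign is absorbed by
    the negated coordinate of [rot2 v]. *)
Lemma apolar_power v (Q : Sym) :
  apolar (power_form r v) Q = r`!%:R * Q.@[rot2 v 0].
Proof.
rewrite meval2 mulr_sumr [RHS](reindex_inj rev_ord_inj) /=.
apply: eq_bigr => i _; have le_ir : (i <= r)%N by rewrite -ltnS.
rewrite mcoeff_power subSS subKn // !mxE /= -(bin_fact le_ir) !natrM.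
rewrite [(- v 0 0) ^+ _]exprNn.
by ring.
Qed.

(** This is the identity [A^T J A = det A * J]. *)
Lemma rot2_act (A : 'M[K]_2) v : rot2 (A *m v) *m A = \det A *: rot2 v.
Proof.
have I2 (F : 'I_2 -> K) : \sum_i F i = F 0 + F 1.
  by rewrite big_ord_recl big_ord1; congr (F _ + F _); apply/val_inj.
apply/rowP => j; rewrite !mxE I2 !mxE /= !I2 det2.
case: j => -[|[|//]] lt_j2 /=.
  have -> : Ordinal lt_j2 = 0 by apply/val_inj.
  by ring.
have -> : Ordinal lt_j2 = 1 by apply/val_inj.
by ring.
Qed.

(** For fixed [Q] both sides are linear in [P], so [power_span] reduces to powers of linear forms.
    There both sides are evaluations of [Q] at proportional points, and homogeneity gives
    [det A ^ r]. *)
Lemma apolar_act (A : 'M[K]_2) (s : seq K) (P Q : Sym) :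
    uniq s -> (r < size s)%N -> r`!%:R != 0 :> K ->
  apolar (sym_act A P) (sym_act A Q) = \det A ^+ r * apolar P Q.
Proof.
move=> s_uniq lt_rs fact_neq0; apply/eqP; rewrite -subr_eq0; apply/eqP.
pose f (P : Sym) : K^o :=
  apolar (sym_act A P) (sym_act A Q) - \det A ^+ r * apolar P Q.
apply: (power_span (f := f)) s_uniq lt_rs _ _ P.
- move=> c P1 P2; rewrite /f sym_act_is_linear !apolar_linl.
  by rewrite -![_ *: _]/(_ * _); ring.
- move=> i; have le_ir : (i <= r)%N by rewrite -ltnS.
  by move: fact_neq0; rewrite -(bin_fact le_ir) natrM mulf_eq0 => /norP[].
move=> t _; rewrite /f sym_act_power !apolar_power /= meval_act rot2_act.
by rewrite mevalZ_homog; ring.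
Qed.

Lemma apolar_neq0 : r`!%:R != 0 :> K -> exists P Q, apolar P Q != 0.
Proof.
(* The pair is [y^r] and [x^r]; the rotated vector is [(1, 0)], so the value is [r!]. *)
move=> fact_neq0; exists (power_form r (delta_mx 1 0)), (monomial K ord_max).
rewrite apolar_power mulf_neq0 // mevalX !big_ord_recl big_ord0 !mnm_tnth /=.
by rewrite !mxE /= subnn expr1n !mul1r oner_neq0.
Qed.

End SmallDegree.

(** * The weighted sum over pairs of points, nonzero when [r >= p] *)

Section LargeDegree.

Variables (p : nat) (p_pr : prime p) (K : fieldType).
Variables (sigma : {rmorphism 'F_p -> K}) (r : nat).

Local Notation Sym := (dhomog 2 K r).
Local Notation ev P v := (P%R : {mpoly K[2]}).@[map_mx sigma v 0].

Definition wedge (v w : 'rV['F_p]_2) : 'F_p := v 0 0 * w 0 1 - v 0 1 * w 0 0.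

(* As [r * p.-2] is congruent to [- r] modulo [p.-1], the weight of a pair of
   independent vectors is [wedge v w ^- r]. *)
Definition point_form (P Q : Sym) : K^o :=
  \sum_v \sum_w sigma (wedge v w) ^+ (r * p.-2) * (ev P v * ev Q w).

Lemma point_form_linl Q : linear (point_form^~ Q).
Proof.
move=> c P1 P2; rewrite /point_form scaler_sumr -big_split.
apply: eq_bigr => v _.
rewrite /= scaler_sumr -big_split; apply: eq_bigr => w _.
by rewrite /= linearP /= -[_ *: _]/(_ * _); ring.
Qed.

Lemma point_form_linr P : linear (point_form P).
Proof.
move=> c Q1 Q2; rewrite /point_form scaler_sumr -big_split.
apply: eq_bigr => v _.
rewrite /= scaler_sumr -big_split; apply: eq_bigr => w _.
by rewrite /= linearP /= -[_ *: _]/(_ * _); ring.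
Qed.

Lemma wedge_mul v w (g : 'M['F_p]_2) :
  wedge (v *m g) (w *m g) = \det g * wedge v w.
Proof.
have I2 (F : 'I_2 -> 'F_p) : \sum_i F i = F 0 + F 1.
  by rewrite big_ord_recl big_ord1; congr (F _ + F _); apply/val_inj.
by rewrite /wedge !mxE !I2 det2; ring.
Qed.

Lemma expFp1 (x : 'F_p) : x != 0 -> x ^+ p.-1 = 1.
Proof.
move=> x_neq0; apply: (mulfI x_neq0); rewrite -exprS prednK ?prime_gt0 // mulr1.
by have := expf_card x; rewrite card_Fp.
Qed.

Lemma expFp_weight (x : 'F_p) : x != 0 -> x ^+ (r * p.-2) * x ^+ r = 1.
Proof.
move=> x_neq0; have p_gt1 := prime_gt1 p_pr.
have p2 : p.-2.+1 = p.-1 by rewrite prednK // -ltnS prednK ?prime_gt0.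
by rewrite -exprD -mulnSr p2 mulnC exprM expFp1 // expr1n.
Qed.

(** Substitute [v *m g] and [w *m g] on the right. The weight then acquires [det g ^ (r * p.-2)],
    which cancels the factor [det g ^ r]. *)
Lemma point_form_act (g : 'M['F_p]_2) (P Q : Sym) : g \in unitmx ->
  point_form (sym_act (map_mx sigma g) P) (sym_act (map_mx sigma g) Q)
    = sigma (\det g) ^+ r * point_form P Q.
Proof.
move=> g_unit; have g_inj : injective (fun v : 'rV_2 => v *m g).
  exact: can_inj (mulmxK g_unit).
have det_neq0 : \det g != 0 by rewrite -unitfE.
rewrite [in RHS]/point_form [in RHS](reindex_inj g_inj) mulr_sumr /=.
apply: eq_bigr => v _; rewrite [in RHS](reindex_inj g_inj) mulr_sumr /=.
apply: eq_bigr => w _. rewrite wedge_mul !meval_act !map_mxM [in RHS]rmorphM.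
rewrite exprMn !mulrA -!rmorphXn -rmorphM [_ ^+ r * _]mulrC.
by rewrite (expFp_weight det_neq0) rmorph1 mul1r.
Qed.

Lemma bump_homog i j : (p <= r)%N ->
  'X_i ^+ (r - p.-1) * ('X_i ^+ p.-1 - 'X_j ^+ p.-1) \is [in K[2], r.-homog].
Proof.
move=> le_pr; have XnP k n : 'X_k ^+ n \is [in K[2], n.-homog].
  by rewrite -[n in n.-homog]mul1n dhomogMn // dhomogX /= mdeg1.
have {2}-> : r = (r - p.-1 + p.-1)%N.
  by rewrite subnK // (leq_trans (leq_pred p)).
by rewrite dhomogM // rpredB.
Qed.

Definition bump i j (le_pr : (p <= r)%N) : Sym := DHomog (bump_homog i j le_pr).

(** By Fermat the difference vanishes when both coordinates are nonzero; the power of ['X_i], whose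
    exponent is positive since [p <= r], vanishes when [v 0 i] does. *)
Lemma ev_bump i j le_pr (v : 'rV['F_p]_2) :
  ev (bump i j le_pr) v = if v 0 j == 0 then sigma (v 0 i) ^+ r else 0.
Proof.
have p_gt1 := prime_gt1 p_pr.
have p1_gt0 : (0 < p.-1)%N by rewrite -ltnS prednK ?prime_gt0.
rewrite /= rmorphM rmorphB !rmorphXn /= !mevalXU !mxE.
rewrite -!rmorphXn -rmorphB -rmorphM.
rewrite -[X in if _ then _ else X](rmorph0 sigma) -fun_if; congr (sigma _).
have [->|vj_neq0] := eqVneq; last first.
  rewrite (expFp1 vj_neq0); have [->|vi_neq0] := eqVneq (v 0 i) 0.
    by rewrite expr0n subn_eq0 leqNgt prednK ?prime_gt0 // le_pr mul0r.
  by rewrite expFp1 // subrr mulr0.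
rewrite [0 ^+ p.-1]expr0n eqn0Ngt p1_gt0 subr0 -exprD subnK //.
by rewrite (leq_trans (leq_pred p)).
Qed.

(** A coordinate axis has [p - 1] nonzero points, and [p = 0] in [K]. *)
Lemma sum_axis i j : i != j ->
  \sum_(v : 'rV['F_p]_2 | (v 0 j == 0) && (v 0 i != 0)) 1 = -1 :> K.
Proof.
move=> ne_ij; have char_p : p \in [pchar K].
  by rewrite (fmorph_pchar sigma) pchar_Fp.
pose axis (a : 'F_p) : 'rV['F_p]_2 := a *: delta_mx 0 i.
rewrite (reindex_onto axis (fun v => v 0 i)) /=.
  transitivity (\sum_(a in predC1 (0 : 'F_p)) (1 : K)).
    apply: eq_bigl => a; rewrite !mxE !eqxx /= mulr1 eqxx andbT (eq_sym j).
    by rewrite (negbTE ne_ij) mulr0 eqxx.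
  rewrite sumr_const cardC1 card_Fp // -subn1 natrB ?prime_gt0 //.
  by rewrite (pcharf0 char_p) sub0r.
move=> v /andP[/eqP vj0 _]; apply/rowP => k; rewrite !mxE eqxx /=.
have [->|ne_ki] := eqVneq k i; first by rewrite mulr1.
rewrite mulr0; suff -> : k = j by [].
apply/val_inj; move: k i j ne_ij ne_ki {vj0 axis} => [[|[|//]] ?].
all: by case=> [[|[|//]] ?] [[|[|//]] ?].
Qed.

Lemma point_form_neq0 : (p <= r)%N -> exists P Q, point_form P Q != 0.
Proof.
move=> le_pr; exists (bump 0 1 le_pr), (bump 1 0 le_pr).
have r_neq0 : (r == 0%N) = false.
  by apply/negbTE; rewrite -lt0n (leq_trans (prime_gt0 p_pr)).
(* The bumps, not the weight, confine the sum to nonzero [v] and [w] on different axes: for [p = 2]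
   the weight is constantly 1. On these pairs [wedge v w = v 0 0 * w 0 1], so the weight cancels
   both [r]-th powers and each pair contributes 1. *)
suff -> : point_form (bump 0 1 le_pr) (bump 1 0 le_pr) = -1 * -1 :> K.
  by rewrite mulrNN mulr1 oner_neq0.
rewrite -{1}(@sum_axis 0 1) // -(@sum_axis 1 0) // big_distrlr /=.
rewrite [RHS]big_mkcond; apply: eq_bigr => v _.
case: ifP => [/andP[/eqP v1 v0_neq0]|v_off]; last first.
  apply: big1 => w _; rewrite ev_bump.
  case: eqP v_off => [v1 /negbFE/eqP ->|]; last by rewrite mul0r mulr0.
  by rewrite rmorph0 expr0n r_neq0 mul0r mulr0.
rewrite [RHS]big_mkcond; apply: eq_bigr => w _; rewrite !ev_bump v1 eqxx mulr1.
have [w0|] /= := eqVneq; last by rewrite !mulr0.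
have [->|w1_neq0] := eqVneq (w 0 1) 0.
  by rewrite rmorph0 expr0n r_neq0 !mulr0.
rewrite /= /wedge v1 mul0r subr0 -!rmorphXn -!rmorphM -exprMn.
by rewrite expFp_weight ?rmorph1 // mulf_neq0.
Qed.

End LargeDegree.

(** * Choice of the form according to the degree, and the theorem *)

Lemma natr_fact_neq0 (K : fieldType) p n :
  p \in [pchar K] -> (n < p)%N -> n`!%:R != 0 :> K.
Proof.
move=> char_p; elim: n => [|n IHn] lt_np; first by rewrite oner_neq0.
rewrite factS natrM mulf_neq0 ?IHn ?(ltnW lt_np) //.
by rewrite -(dvdn_pcharf char_p) gtnNdvd.
Qed.

Lemma exists_semiinvariant_form p (p_pr : prime p) (K : fieldType)
    (sigma : {rmorphism 'F_p -> K}) r :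
  exists beta : dhomog 2 K r -> dhomog 2 K r -> K^o,
    [/\ forall Q, linear (beta^~ Q), forall P, linear (beta P),
        forall (g : 'M['F_p]_2) P Q, g \in unitmx ->
          beta (sym_act (map_mx sigma g) P) (sym_act (map_mx sigma g) Q)
            = sigma (\det g) ^+ r * beta P Q
      & exists P Q, beta P Q != 0].
Proof.
have char_p : p \in [pchar K] by rewrite (fmorph_pchar sigma) pchar_Fp.
have [lt_rp | le_pr] := ltnP r p; last first.
  exists (@point_form p K sigma r); split.
  - exact: point_form_linl.
  - exact: point_form_linr.
  - exact: point_form_act.
  exact: point_form_neq0.
have fact_neq0 := natr_fact_neq0 char_p lt_rp.
exists (@apolar K r); split; [exact: apolar_linl | exact: apolar_linr | | ].
  move=> g P Q _; rewrite -det_map_mx.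
  (* The images of the [p] elements of ['F_p] are the more than [r] sample points. *)
  apply: (@apolar_act _ _ _ (map sigma (enum 'F_p))) => //.
    by rewrite map_inj_uniq ?enum_uniq //; apply: fmorph_inj.
  by rewrite size_map -cardE card_Fp.
exact: apolar_neq0.
Qed.

Theorem proposition3p11 (p : nat) (p_pr : prime p)
    (F : finFieldType) (cardF : #|F| = (p ^ 2)%N)
    (toF : {rmorphism 'F_p -> F})
    (K : closedFieldType) (toK : {rmorphism F -> K})
    (algK : integralRange (toK \o toF))
    (r k : nat) :
  distinguished (GLFp_sub toF)
    (V_repr (pchar_Fp_ext toF p_pr) toK r r k)
    (subg_repr (detX_repr toK (r + k)) (GLFp_sub toF)).
Proof.
have [beta [linl linr beta_act [P [Q PQ_neq0]]]] :=
  exists_semiinvariant_form p_pr (toK \o toF) r.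
(* The form [beta], read as a functional on the tensor square, times the identity of the determinant
   factor. *)
pose f := tprod (form_mx (gram_mx beta)) (1%:M : 'M_1).
exists f.
  move=> _ /morphimP[g _ _ ->] /=.
  (* Entries from ['F_p] satisfy [x ^ p = x], so both symmetric powers carry the same action of
     [g]. *)
  have -> : map_mx (toK \o pFrobenius_aut (pchar_Fp_ext toF p_pr))
        (map_mx toF (GLval g))
      = map_mx toK (map_mx toF (GLval g)) :> 'M_2.
    apply/matrixP => i j; rewrite !mxE /= pFrobenius_autE -rmorphXn.
    by have := expf_card (GLval g i j); rewrite [X in _ ^+ X]card_Fp // => ->.
  rewrite {}/f tprod_rowM form_mxM -map_mx_comp.
  (* The form contributes [det ^ r]; the remaining [det ^ k] comes from the twist. *)
  pose c := toK (toF (\det (GLval g))) ^+ r.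
  rewrite (gram_mx_act linl linr (c := c)); last first.
    by move=> P' Q'; apply: beta_act; apply: (GL_unitmx g).
  rewrite form_mxZ mul1mx tprodZl det_map_mx mul_scalar_mx exprD -scalerA.
  by rewrite -[in LHS]scalemx1 tprodZr.
(* If [f] vanished, so would the Gram matrix, and with it [beta P Q]. *)
apply: contraNneq PQ_neq0 => f0.
suff G0 : gram_mx beta = 0.
  by rewrite (form_gramE linl linr) G0 mulmx0 mul0mx mxE.
exact/form_mx_eq0/tprod1r_eq0.
Qed.
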